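(* Let $(KNP): K\xrightarrow{i_0}N\xrightarrow{\pi_0}P$ and $(PQR): P\xrightarrow{\bar\jmath}Q\xrightarrow{\bar\phi}R$ be group extensions. Let $(G,j,\pi)$ be an iterated extension of $(KNP)$ by $(PQR)$ with mod-$K$ outer action $\Theta:Q\to\mathrm{Out}(N;K)$, and let $\eta\in\mathrm{Aut}(KNP)$ be a $\Theta$-compatible automorphism of the extension $(KNP)$. Then the iterated extension $(G,j^\eta,\pi)$, where $j^\eta:=j\circ\eta$, is isomorphic to $(G,j,\pi)$ if and only if there exists an automorphism $\xi\in\mathrm{Aut}(KGQ)$ of the $Q$-main extension $(KGQ)$ such that $\eta$ is the restriction $\xi|_N$ of $\xi$ to $N$.
   Context: A group extension $K\xrightarrow{i_0}N\xrightarrow{\pi_0}P$ consists of an injective homomorphism $i_0$ and a surjective homomorphism $\pi_0$ with $i_0(K)=\mathrm{Ker}(\pi_0)$; groups are identified with their images under the given injections. An iterated extension of $(KNP)$ by $(PQR)$ is a triple $(G,j,\pi)$ with $G$ a group, $j:N\to G$ an injective homomorphism and $\pi:G\to Q$ a surjective homomorphism such that, with $i:=j\circ i_0$ and $\phi:=\bar\phi\circ\pi$, one has $\pi\circ j=\bar\jmath\circ\pi_0$, $j(N)=\mathrm{Ker}(\phi)$ and $i(K)=\mathrm{Ker}(\pi)$. Its $Q$-main extension $(KGQ)$ is the extension $(G,i,\pi)$ of $K$ by $Q$. Two iterated extensions $(G_\ell,j_\ell,\pi_\ell)$, $\ell=1,2$, are isomorphic iff there is a group isomorphism $\varphi:G_1\to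 G_2$ with $\varphi\circ j_1=j_2$ and $\pi_2\circ\varphi=\pi_1$. $\mathrm{Aut}_K(N)$ is the group of automorphisms of $N$ mapping $K$ onto $K$, and $\mathrm{Out}(N;K):=\mathrm{Aut}_K(N)/\complement_N(K)$, where $\complement_N(K)$ is the group of inner automorphisms of $N$ by elements of $K$. The mod-$K$ outer action of $(G,j,\pi)$ is the homomorphism $\Theta:Q\to\mathrm{Out}(N;K)$ sending $\pi(g)$ to the class of conjugation by $g\in G$ on $N$ (via $j$). An automorphism $\eta\in\mathrm{Aut}_K(N)$ is $\Theta$-compatible if its image in $\mathrm{Out}(N;K)$ commutes with $\Theta(q)$ for all $q\in Q$. $\mathrm{Aut}(KNP):=\{\eta\in\mathrm{Aut}(N):\eta\circ i_0=i_0,\ \pi_0\circ\eta=\pi_0\}$ and $\mathrm{Aut}(KGQ):=\{\xi\in\mathrm{Aut}(G):\xi\circ i=i,\ \pi\circ\xi=\pi\}$. For $\xi\in\mathrm{Aut}(KGQ)$, $\xi|_N\in\mathrm{Aut}(KNP)$ is characterized by $j\circ\xi|_N=\xi\circ j$. *)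

(* Defs.v *)
From HB Require Import structures.
From mathcomp Require Import all_boot all_classical.

Set Implicit Arguments.
Unset Strict Implicit.
Unset Printing Implicit Defensive.

Local Open Scope classical_set_scope.
Local Open Scope group_scope.
Local Open Scope quotient_scope.

(* Groups are arbitrary, possibly infinite, [groupType]s. *)

Notation "{ 'hom' G -> H }" := (UMagmaMorphism.type G%type H%type)
  (at level 0, G at level 98, H at level 99,
   format "{ 'hom'  G  ->  H }") : type_scope.

Definition ker (G H : groupType) (f : G -> H) : set G := [set x | f x = 1].

Section Automorphisms.
Variable G : groupType.

Definition is_aut : pred (G -> G) :=
  fun f => `[< {morph f : x y / x * y} /\ bijective f >].

Record aut := Aut { aut_fun : G -> G; _ : is_aut aut_fun }.

HB.instance Definition _ := [isSub for aut_fun].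
HB.instance Definition _ := [Choice of aut by <:].

Coercion aut_fun : aut >-> Funclass.

Lemma autM (a : aut) : {morph a : x y / x * y}.
Proof. by case: a => f /= /asboolP[]. Qed.

Lemma aut_bij (a : aut) : bijective a.
Proof. by case: a => f /= /asboolP[]. Qed.

Lemma aut1 (a : aut) : a 1 = 1.
Proof. by apply: (mulgI (a 1)); rewrite -autM !mulg1. Qed.

HB.instance Definition _ (a : aut) :=
  isUMagmaMorphism.Build G G (aut_fun a) (aut1 a, @autM a).

Lemma autP (a b : aut) : a =1 b -> a = b.
Proof. by move=> ab; apply/val_inj/funext. Qed.

Lemma is_aut_id : is_aut idfun.
Proof. by apply/asboolP; split=> //; exists idfun. Qed.

Lemma is_aut_comp (a b : aut) : is_aut (a \o b).
Proof.
apply/asboolP; split=> [x y /=|]; first by rewrite !autM.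
by apply: bij_comp; apply: aut_bij.
Qed.

Lemma aut_inv_ex (a : aut) : exists g, cancel a g /\ cancel g a.
Proof. by have [g ag ga] := aut_bij a; exists g. Qed.

Definition aut_inv_fun (a : aut) : G -> G := projT1 (cid (aut_inv_ex a)).

Lemma aut_funK (a : aut) : cancel a (aut_inv_fun a).
Proof. by rewrite /aut_inv_fun; case: cid => g /= []. Qed.

Lemma aut_inv_funK (a : aut) : cancel (aut_inv_fun a) a.
Proof. by rewrite /aut_inv_fun; case: cid => g /= []. Qed.

Lemma is_aut_inv (a : aut) : is_aut (aut_inv_fun a).
Proof.
apply/asboolP; split; last first.
  by exists a; [apply: aut_inv_funK | apply: aut_funK].
move=> x y; apply: (can_inj (aut_funK a)).
by rewrite autM !aut_inv_funK.
Qed.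

Definition aut_one : aut := Aut is_aut_id.
Definition aut_mul (a b : aut) : aut := Aut (is_aut_comp a b).
Definition aut_inv (a : aut) : aut := Aut (is_aut_inv a).

Fact aut_mulA : associative aut_mul. Proof. by move=> a b c; apply: autP. Qed.
Fact aut_mul1 : left_id aut_one aut_mul. Proof. by move=> a; apply: autP. Qed.
Fact aut_1mul : right_id aut_one aut_mul. Proof. by move=> a; apply: autP. Qed.
Fact aut_mulV : left_inverse aut_one aut_inv aut_mul.
Proof. by move=> a; apply: autP => x; apply: aut_funK. Qed.
Fact aut_Vmul : right_inverse aut_one aut_inv aut_mul.
Proof. by move=> a; apply: autP => x; apply: aut_inv_funK. Qed.

HB.instance Definition _ :=
  isGroup.Build aut aut_mulA aut_mul1 aut_1mul aut_mulV aut_Vmul.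

End Automorphisms.

Section RelativeOut.
Variables (K N : groupType) (i0 : {hom K -> N}).

(* [autK i0] is Aut_K(N), where K is identified with its image under [i0]. *)
Definition stabK : pred (aut N) :=
  fun a => `[< aut_fun a @` range i0 = range i0 >].

Record autK := AutK { autK_val : aut N; _ : stabK autK_val }.

HB.instance Definition _ := [isSub for autK_val].
HB.instance Definition _ := [Choice of autK by <:].

Lemma stabK_closed : group_closed stabK.
Proof.
split=> [|a b]; rewrite !unfold_in; first exact/asboolP/image_id.
move=> /asboolP aK /asboolP bK; apply/asboolP.
have bVK : aut_inv_fun b @` range i0 = range i0.
  rewrite -[in LHS]bK (image_comp b) -[RHS]image_id; congr image.
  by apply/funext => x /=; apply: aut_funK.
by rewrite -[RHS]aK -[in RHS]bVK (image_comp (aut_inv_fun b)).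
Qed.

HB.instance Definition _ := SubChoice_isSubGroup.Build (aut N) stabK autK
  stabK_closed.

Definition inn_fun (k : K) (n : N) : N := i0 k * n / i0 k.

Lemma is_aut_inn k : is_aut (inn_fun k).
Proof.
apply/asboolP; split=> [x y|]; first by rewrite /inn_fun !mulgA mulgVK.
exists (fun n => (i0 k)^-1 * n * i0 k) => n; rewrite /inn_fun.
  by rewrite !mulgA mulgVK mulVg mul1g.
by rewrite !mulgA mulgK mulgV mul1g.
Qed.

Lemma stabK_inn k : stabK (Aut (is_aut_inn k)).
Proof.
apply/asboolP/seteqP; split=> [_ [_ [h _ <-] <-]|_ [h _ <-]] /=.
  by exists (k * h / k) => //; rewrite /inn_fun gmulfF gmulfM.
exists (i0 (k^-1 * h * k)); first by exists (k^-1 * h * k).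
by rewrite /inn_fun !gmulfM gmulfV !mulgA mulgK mulgV mul1g.
Qed.

(* The automorphism n |-> k n k^-1 of N. *)
Definition innK (k : K) : autK := AutK (stabK_inn k).

Lemma autKP (a b : autK) : autK_val a =1 autK_val b -> a = b.
Proof. by move=> ab; apply/val_inj/autP. Qed.

Lemma innK1 : innK 1 = 1.
Proof.
by apply: autKP => n /=; rewrite /inn_fun gmulf1 mul1g divg1.
Qed.

Lemma innKM k h : innK (k * h) = innK k * innK h.
Proof.
by apply: autKP => n /=; rewrite /inn_fun gmulfM invgM !mulgA.
Qed.

Lemma innKV k : innK k^-1 = (innK k)^-1.
Proof. by apply: (mulgI (innK k)); rewrite -innKM !mulgV innK1. Qed.

Lemma innK_normal (a : autK) k : exists h, innK k * a = a * innK h.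
Proof.
have /asboolP aK : stabK (autK_val a) by case: a.
have [_ [h _ <-] ah] : (autK_val a @` range i0) (i0 k) by rewrite aK; exists k.
exists h; apply: autKP => n /=; rewrite /inn_fun -ah.
by rewrite -autM -gmulfF.
Qed.

(* Out(N; K) is the group of left cosets of the (normal) subgroup of inner *)
(* automorphisms of N by elements of K; [outcl] is the projection. *)
Definition out_rel : rel autK := fun a b => `[< exists k, b = a * innK k >].

Fact out_rel_refl : reflexive out_rel.
Proof. by move=> a; apply/asboolP; exists 1; rewrite innK1 mulg1. Qed.

Fact out_rel_sym : symmetric out_rel.
Proof.
have H a b : out_rel a b -> out_rel b a.
  move=> /asboolP[k ->]; apply/asboolP; exists k^-1.
  by rewrite innKV mulgK.
by move=> a b; apply/idP/idP; apply: H.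
Qed.

Fact out_rel_trans : transitive out_rel.
Proof.
move=> b a c /asboolP[k ->] /asboolP[h ->]; apply/asboolP; exists (k * h).
by rewrite innKM mulgA.
Qed.

Canonical out_equiv := EquivRel out_rel out_rel_refl out_rel_sym out_rel_trans.

Definition out := {eq_quot out_equiv}.

HB.instance Definition _ := Choice.on out.
HB.instance Definition _ := EqQuotient.on out.

Definition outcl (a : autK) : out := \pi_out a.

Lemma outclP (a b : autK) : outcl a = outcl b <-> exists k, b = a * innK k.
Proof.
split=> [/eqmodP/asboolP //|ab]; exact/eqmodP/asboolP.
Qed.

Lemma outcl_repr (x : out) : outcl (repr x) = x.
Proof. exact: reprK. Qed.

Definition out_one : out := outcl 1.
Definition out_mul (x y : out) : out := outcl (repr x * repr y).
Definition out_inv (x : out) : out := outcl (repr x)^-1.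

Lemma outclM (a b : autK) : outcl (a * b) = out_mul (outcl a) (outcl b).
Proof.
have /outclP[k ka] := esym (outcl_repr (outcl a)).
have /outclP[h hb] := esym (outcl_repr (outcl b)).
apply/outclP; rewrite ka hb; have [l lb] := innK_normal b k.
by exists (l * h); rewrite innKM !mulgA -[a * b * _]mulgA -lb !mulgA.
Qed.

Lemma outclV (a : autK) : outcl a^-1 = out_inv (outcl a).
Proof.
have /outclP[k ka] := esym (outcl_repr (outcl a)).
apply/outclP; rewrite ka invgM -innKV; exact: innK_normal.
Qed.

Fact out_mulA : associative out_mul.
Proof.
move=> x y z; rewrite -[x]outcl_repr -[y]outcl_repr -[z]outcl_repr.
by rewrite -!outclM mulgA.
Qed.
Fact out_mul1 : left_id out_one out_mul.
Proof. by move=> x; rewrite -[x]outcl_repr -outclM mul1g. Qed.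
Fact out_1mul : right_id out_one out_mul.
Proof. by move=> x; rewrite -[x]outcl_repr -outclM mulg1. Qed.
Fact out_mulV : left_inverse out_one out_inv out_mul.
Proof. by move=> x; rewrite -[x]outcl_repr -outclV -outclM mulVg. Qed.
Fact out_Vmul : right_inverse out_one out_inv out_mul.
Proof. by move=> x; rewrite -[x]outcl_repr -outclV -outclM mulgV. Qed.

HB.instance Definition _ :=
  isGroup.Build out out_mulA out_mul1 out_1mul out_mulV out_Vmul.

Fact outcl_morphism : monoid_morphism outcl.
Proof. by split=> // a b; rewrite outclM. Qed.

HB.instance Definition _ := isUMagmaMorphism.Build autK out outcl
  outcl_morphism.

End RelativeOut.

Record extension (K N P : groupType) := Extension {
  ext_inj : {hom K -> N};
  ext_surj : {hom N -> P};
  ext_injP : injective ext_inj;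
  ext_surjP : range ext_surj = setT;
  ext_exact : range ext_inj = ker ext_surj }.

(* Automorphisms of an extension inducing the identity on both ends. *)
Record ext_aut (K N P : groupType) (E : extension K N P) := ExtAut {
  ext_aut_val :> aut N;
  ext_aut_inj : ext_aut_val \o ext_inj E =1 ext_inj E;
  ext_aut_surj : ext_surj E \o ext_aut_val =1 ext_surj E }.

Lemma stabK_ext_aut (K N P : groupType) (E : extension K N P)
  (eta : ext_aut E) : stabK (ext_inj E) eta.
Proof.
apply/asboolP/seteqP; split=> [_ [_ [k _ <-] <-]|_ [k _ <-]] /=.
  by exists k => //; rewrite -[LHS](ext_aut_inj eta).
by exists (ext_inj E k); [exists k | apply: (ext_aut_inj eta)].
Qed.

Definition ext_autK (K N P : groupType) (E : extension K N P)
  (eta : ext_aut E) : autK (ext_inj E) := AutK (stabK_ext_aut eta).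

Record iterated_extension (K N P Q R : groupType)
    (KNP : extension K N P) (PQR : extension P Q R) := IteratedExtension {
  it_group : groupType;
  it_inj : {hom N -> it_group};
  it_surj : {hom it_group -> Q};
  it_injP : injective it_inj;
  it_surjP : range it_surj = setT;
  it_comm : it_surj \o it_inj =1 ext_inj PQR \o ext_surj KNP;
  it_exactN : range it_inj = ker (ext_surj PQR \o it_surj);
  it_exactK : range (it_inj \o ext_inj KNP) = ker it_surj }.

Section IteratedExtension.
Variables (K N P Q R : groupType).
Variables (KNP : extension K N P) (PQR : extension P Q R).

Definition it_isomorphic (E1 E2 : iterated_extension KNP PQR) : Prop :=
  exists phi : {hom it_group E1 -> it_group E2},
    [/\ bijective phi, phi \o it_inj E1 =1 it_inj E2
      & it_surj E2 \o phi =1 it_surj E1].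

Variable E : iterated_extension KNP PQR.
Notation G := (it_group E).
Notation j := (it_inj E).
Notation pi := (it_surj E).
Notation i0 := (ext_inj KNP).

Lemma main_injP : injective (j \o i0).
Proof. exact: inj_comp (@it_injP _ _ _ _ _ _ _ E) (@ext_injP _ _ _ KNP). Qed.

(* The Q-main extension (KGQ): it forgets j and remembers only j o i0. *)
Definition main_extension : extension K G Q :=
  @Extension K G Q (j \o i0) pi main_injP (it_surjP E) (it_exactK E).

Section Twist.
Variable eta : ext_aut KNP.

Lemma twist_injP : injective (j \o eta).
Proof.
exact: inj_comp (@it_injP _ _ _ _ _ _ _ E) (bij_inj (aut_bij eta)).
Qed.

Lemma twist_comm :
  pi \o (j \o eta) =1 ext_inj PQR \o ext_surj KNP.
Proof.
by move=> n; rewrite /= [LHS](it_comm E) /=; congr (ext_inj PQR _);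
  apply: (ext_aut_surj eta).
Qed.

Lemma twist_exactN : range (j \o eta) = ker (ext_surj PQR \o pi).
Proof.
rewrite -it_exactN; apply/seteqP; split=> [_ [n _ <-]|_ [n _ <-]] /=.
  by exists (eta n).
by have [f fK Kf] := aut_bij eta; exists (f n); rewrite //= Kf.
Qed.

Lemma twist_exactK : range (j \o eta \o i0) = ker pi.
Proof.
rewrite -it_exactK; congr image; apply/funext => k /=; congr (j _).
exact: (ext_aut_inj eta).
Qed.

(* (G, j o eta, pi) *)
Definition twist : iterated_extension KNP PQR :=
  @IteratedExtension K N P Q R KNP PQR G (j \o eta) pi
    twist_injP (it_surjP E) twist_comm twist_exactN twist_exactK.

End Twist.

Lemma conj_ex (g : G) (n : N) : exists m, j m = g * j n / g.
Proof.
have : range j (g * j n / g).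
  have : range j (j n) by exists n.
  rewrite it_exactN /ker /= => jn1.
  by rewrite !gmulfF !gmulfM jn1 mulg1 divgg.
by case=> m _ <-; exists m.
Qed.

(* Conjugation n |-> g n g^-1 of N by g \in G, via j. *)
Definition conj_fun (g : G) (n : N) : N := projT1 (cid (conj_ex g n)).

Lemma conj_funE g n : j (conj_fun g n) = g * j n / g.
Proof. by rewrite /conj_fun; case: cid. Qed.

Lemma conj_funM g h n : conj_fun (g * h) n = conj_fun g (conj_fun h n).
Proof.
by apply: (@it_injP _ _ _ _ _ _ _ E); rewrite !conj_funE invgM !mulgA.
Qed.

Lemma conj_fun1 n : conj_fun 1 n = n.
Proof.
by apply: (@it_injP _ _ _ _ _ _ _ E); rewrite !conj_funE mul1g divg1.
Qed.

Lemma is_aut_conj g : is_aut (conj_fun g).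
Proof.
apply/asboolP; split=> [x y|].
  apply: (@it_injP _ _ _ _ _ _ _ E).
  by rewrite gmulfM !conj_funE gmulfM !mulgA mulgVK.
by exists (conj_fun g^-1) => n; rewrite -conj_funM ?mulVg ?mulgV conj_fun1.
Qed.

Lemma conj_fun_K g k : range i0 (conj_fun g (i0 k)).
Proof.
have : range (j \o i0) (j (conj_fun g (i0 k))).
  have : range (j \o i0) (j (i0 k)) by exists k.
  rewrite it_exactK /ker /= conj_funE => jk1.
  by rewrite !gmulfF !gmulfM jk1 mulg1 divgg.
by case=> h _ /(@it_injP _ _ _ _ _ _ _ E) <-; exists h.
Qed.

Lemma stabK_conj g : stabK i0 (Aut (is_aut_conj g)).
Proof.
apply/asboolP/seteqP; split=> [_ [_ [k _ <-] <-]|_ [k _ <-]] /=.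
  exact: conj_fun_K.
exists (conj_fun g^-1 (i0 k)); first exact: conj_fun_K.
by rewrite -conj_funM mulgV conj_fun1.
Qed.

Definition conjK (g : G) : autK i0 := AutK (stabK_conj g).

Lemma conjKM g h : conjK (g * h) = conjK g * conjK h.
Proof. by apply: autKP => n; apply: conj_funM. Qed.

Lemma conjK1 : conjK 1 = 1.
Proof. by apply: autKP => n; apply: conj_fun1. Qed.

Lemma surj_ex (q : Q) : exists g, pi g = q.
Proof.
have : range pi q by rewrite it_surjP.
by case=> g _ <-; exists g.
Qed.

Definition outer_action_fun (q : Q) : out i0 :=
  outcl (conjK (projT1 (cid (surj_ex q)))).

Lemma outer_action_funE g : outer_action_fun (pi g) = outcl (conjK g).
Proof.
rewrite /outer_action_fun; case: cid => h /= hg.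
have : ker pi (h^-1 * g) by rewrite /ker /= gmulfM gmulfV hg mulVg.
rewrite -it_exactK => -[k _ /= hk]; apply/outclP; exists k.
rewrite -[g](mulKg (h^-1)) invgK -hk conjKM; congr (_ * _).
apply: autKP => n /=; apply: (@it_injP _ _ _ _ _ _ _ E).
by rewrite conj_funE /inn_fun gmulfF gmulfM.
Qed.

Fact outer_action_morphism : monoid_morphism outer_action_fun.
Proof.
split=> [|x y]; first by rewrite -(gmulf1 (s := pi)) outer_action_funE conjK1 gmulf1.
have [[g <-] [h <-]] := (surj_ex x, surj_ex y).
by rewrite -gmulfM !outer_action_funE conjKM gmulfM.
Qed.

HB.instance Definition _ :=
  isUMagmaMorphism.Build Q (out i0) outer_action_fun outer_action_morphism.

(* The mod-K outer action Theta : Q -> Out(N; K), characterized by *)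
(* [outer_actionE]. *)
Definition outer_action : {hom Q -> out i0} := outer_action_fun.

Lemma outer_actionE g : outer_action (pi g) = outcl (conjK g).
Proof. exact: outer_action_funE. Qed.

(* The restriction xi|_N is the eta characterized by j o eta = xi o j. *)
Definition restricts_to (xi : ext_aut main_extension) (eta : ext_aut KNP) :
  Prop := j \o eta =1 xi \o j.

End IteratedExtension.

Definition compatible (K N Q : groupType) (i0 : {hom K -> N})
    (Theta : {hom Q -> out i0}) (a : autK i0) : Prop :=
  forall q, commute (outcl a) (Theta q).

(* Main.v *)
Require Import Defs.
From mathcomp Require Import all_boot all_classical.

(** An isomorphism from [(G, j o eta, pi)] to [(G, j, pi)] is an automorphism
    [phi] of [G] over [Q] with [phi o j o eta = j], that is, with
    [j o eta = phi^-1 o j].  So [phi |-> xi := phi^-1] exchanges such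
    isomorphisms with the automorphisms of [G] over [Q] that restrict to [eta]
    on [N].  Such a [xi] automatically fixes [K] pointwise, because [eta] does:
    [xi (j (i0 k)) = j (eta (i0 k)) = j (i0 k)].  Hence it is an automorphism
    of the [Q]-main extension. *)

Lemma aut_inv_surj (G Q : groupType) (pi : G -> Q) (a : aut G) :
  pi \o a =1 pi -> pi \o aut_inv a =1 pi.
Proof. by move=> pia x; rewrite -[LHS]pia /= aut_inv_funK. Qed.

Theorem proposition10p12 (K N P Q R : groupType)
    (KNP : extension K N P) (PQR : extension P Q R)
    (E : iterated_extension KNP PQR) (eta : ext_aut KNP)
    (Theta_compatible : compatible (outer_action E) (ext_autK eta)) :
  it_isomorphic (twist E eta) E <->
  exists xi : ext_aut (main_extension E), restricts_to xi eta.
Proof.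
split=> [[phi [phi_bij phi_inj phi_surj]]|[xi xi_res]].
  have phi_aut : @is_aut (it_group E) phi.
    by apply/asboolP; split=> // x y; rewrite gmulfM.
  pose a : aut (it_group E) := Aut phi_aut.
  have a_res n : aut_inv a (it_inj E n) = it_inj E (eta n).
    by rewrite -[it_inj E n]phi_inj /=; apply: (aut_funK a).
  have aK : aut_inv a \o ext_inj (main_extension E)
      =1 ext_inj (main_extension E).
    by move=> k; rewrite [LHS]a_res; congr (it_inj E _); apply: ext_aut_inj.
  have aQ := aut_inv_surj _ _ (it_surj E) a phi_surj.
  by exists (@ExtAut _ _ _ (main_extension E) (aut_inv a) aK aQ) => n /=;
    rewrite -[LHS]a_res.
exists (aut_inv xi); split.
- exact: aut_bij.
- by move=> n; rewrite /= [it_inj E (eta n)]xi_res; apply: (aut_funK xi).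
- exact/aut_inv_surj/(ext_aut_surj xi).
Qed.
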